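(* Let $X$ be an arbitrary topological space and let $X_H$ be its Hausdorff reflection. Then $X$ and $X_H$ have the same shape, i.e., $X$ and $X_H$ are isomorphic objects of the shape category.
   Context: Hausdorff reflection. For a topological space $X$, define an equivalence relation $R_3$ on $X$ by: $x\,R_3\,y$ if and only if $f(x)=f(y)$ for every continuous map $f:X\to Z$ into a Hausdorff space $Z$. The Hausdorff reflection of $X$ is the quotient space $X_H=X/R_3$ with the quotient topology, together with the quotient map $\mu_X:X\to X_H$, which is continuous and surjective. The space $X_H$ is Hausdorff, and $\mu_X$ has the following universal property: every continuous map $f:X\to Z$ with $Z$ Hausdorff factors as $f=g\circ\mu_X$ for a continuous map $g:X_H\to Z$, necessarily unique because $\mu_X$ is surjective. This determines $X_H$ up to homeomorphism. Shape. For topological spaces $Z,R$, let $[Z,R]$ denote the set of homotopy classes of continuous maps $Z\to R$, and $[h]$ the homotopy class of $h$. A metric ANR is a metrizable space that is an absolute neighborhood retract for the class of metrizable spaces. The shape category (in the sense of Mardešić and Mardešić–Segal, for arbitrary topological spaces) can be described as follows. Its objects are all topological spaces. A shape morphism $X\to Y$ is a natural transformation from the functor $P\mapsto [Y,P]$ to the functor $P\mapsto [X,P]$, where $P$ ranges over the homotopy category of metric ANRs (objects: metric ANRs; morphisms: homotopy classes of continuous maps, acting by post-composition); the composite of shape morphisms $X\to Y$ and $Y\to W$ is obtained by composing the natural transformations $[W,-]\to[Y,-]\to[X,-]$. A continuous map $f:X\to Y$ induces the shape morphism given by $[h]\mapsto[h\circ f]$. Two spaces have the same shape if they are isomorphic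 in the shape category. *)

(* Defs.v *)
From HB Require Import structures.
From mathcomp Require Import all_boot all_order all_algebra.
From mathcomp Require Import all_classical all_reals all_analysis.
From mathcomp Require Import lra.

Set Implicit Arguments.
Unset Strict Implicit.
Unset Printing Implicit Defensive.

Import Order.TTheory GRing.Theory Num.Theory.
Import numFieldNormedType.Exports.

Local Open Scope classical_set_scope.
Local Open Scope ring_scope.
Local Open Scope quotient_scope.

(* Spaces are arbitrary [topologicalType]s, all in the one universe of that
   (universe-monomorphic) structure; they may be empty.  The parameter
   [R : realType] is the real line that [0, 1] and metrics refer to. *)

Section HausdorffReflection.
Variable X : topologicalType.

Definition R3 (x y : X) : Prop :=
  forall (Z : topologicalType) (f : X -> Z),
    hausdorff_space Z -> continuous f -> f x = f y.

(* [{eq_quot _}] wants a boolean relation. *)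
Definition R3b (x y : X) : bool := `[< R3 x y >].

Lemma R3b_refl : reflexive R3b.
Proof. by move=> x; apply/asboolP. Qed.

Lemma R3b_sym : symmetric R3b.
Proof.
by move=> x y; apply/asbool_equiv_eq; split=> xy Z f hZ cf; rewrite (xy Z f).
Qed.

Lemma R3b_trans : transitive R3b.
Proof.
move=> y x z /asboolP xy /asboolP yz; apply/asboolP => Z f hZ cf.
by rewrite (xy Z f)// (yz Z f).
Qed.

Canonical R3_equiv := EquivRel R3b R3b_refl R3b_sym R3b_trans.

Definition hausdorff_reflection : topologicalType :=
  quotient_topology {eq_quot R3_equiv}.

Definition hausdorff_proj : X -> hausdorff_reflection :=
  \pi_(quotient_topology {eq_quot R3_equiv}).

Lemma hausdorff_proj_continuous : continuous hausdorff_proj.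
Proof. exact: pi_continuous. Qed.

Lemma hausdorff_projP (x y : X) :
  hausdorff_proj x = hausdorff_proj y <-> R3 x y.
Proof.
by split=> [/eqmodP/asboolP//|xy]; apply/eqmodP; apply/asboolP.
Qed.

Lemma hausdorff_proj_surj (q : hausdorff_reflection) :
  exists x, hausdorff_proj x = q.
Proof. by exists (repr q); exact: reprK. Qed.

Lemma hausdorff_reflection_factor (Z : topologicalType) (f : X -> Z) :
  hausdorff_space Z -> continuous f ->
  exists2 g : hausdorff_reflection -> Z, continuous g & f = g \o hausdorff_proj.
Proof.
move=> hZ cf.
have gE x : f (repr (hausdorff_proj x)) = f x.
  by apply: ((hausdorff_projP _ _).1 _ Z f hZ cf); exact: reprK.
exists (f \o repr); last by apply/funext => x /=; rewrite gE.
apply/quotient_continuous; rewrite [X in continuous X](_ : _ = f)//.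
by apply/funext => x; exact: gE.
Qed.

Lemma hausdorff_reflection_hausdorff : hausdorff_space hausdorff_reflection.
Proof.
move=> p q; have [x <-] := hausdorff_proj_surj p.
have [y <-] := hausdorff_proj_surj q => clxy.
apply/hausdorff_projP => Z f hZ cf; apply: (hZ) => A B Ax By.
have [g cg fE] := hausdorff_reflection_factor hZ cf.
rewrite fE in Ax By.
by have [z [Az Bz]] := clxy _ _ (cg _ _ Ax) (cg _ _ By); exists (g z).
Qed.

End HausdorffReflection.

Definition unit_itv (R : realType) : set R := `[0, 1]%classic.
Arguments unit_itv : clear implicits.

Lemma unit_itv0_mem (R : realType) : 0 \in unit_itv R.
Proof. by apply/mem_set; rewrite /unit_itv /= in_itv /= lexx ler01. Qed.

Lemma unit_itv1_mem (R : realType) : 1 \in unit_itv R.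
Proof. by apply/mem_set; rewrite /unit_itv /= in_itv /= lexx ler01. Qed.

Definition unit_itv0 (R : realType) : unit_itv R := SigSub (unit_itv0_mem R).
Definition unit_itv1 (R : realType) : unit_itv R := SigSub (unit_itv1_mem R).

(* In the domain of [H], [unit_itv R] is the subtype, with its subspace
   topology. *)
Definition homotopic (R : realType) (Z P : topologicalType) (f g : Z -> P) :
    Prop :=
  exists H : Z * unit_itv R -> P,
    [/\ continuous H,
        forall z, H (z, unit_itv0 R) = f z &
        forall z, H (z, unit_itv1 R) = g z].

Lemma pair_continuous (T U V : topologicalType) (f : T -> U) (g : T -> V) :
  continuous f -> continuous g -> continuous (fun x => (f x, g x)).
Proof. by move=> cf cg x; apply: (cvg_pair (cf x) (cg x)). Qed.

Lemma comp_continuous (T U V : topologicalType) (f : T -> U) (g : U -> V) :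
  continuous f -> continuous g -> continuous (fun x => g (f x)).
Proof. by move=> cf cg x; apply: continuous_comp; [exact: cf|exact: cg]. Qed.

Lemma fst_continuous (T U : topologicalType) : continuous (@fst T U).
Proof. by move=> x; exact: cvg_fst. Qed.

Lemma snd_continuous (T U : topologicalType) : continuous (@snd T U).
Proof. by move=> x; exact: cvg_snd. Qed.

Lemma unit_itv_val_continuous (R : realType) :
  continuous (set_val : unit_itv R -> R).
Proof. exact: initial_continuous. Qed.

Section HomotopyEquivalence.
Variable R : realType.

Lemma clamp_subproof (t : R) : Num.max 0 (Num.min 1 t) \in unit_itv R.
Proof.
apply/mem_set; rewrite /unit_itv /= in_itv /= le_max lexx /=.
by rewrite ge_max ler01 ge_min lexx.
Qed.

Definition clamp (t : R) : unit_itv R := SigSub (clamp_subproof t).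

Lemma clamp_continuous : continuous clamp.
Proof.
apply: (@continuous_comp_initial _ _ _ (@set_val _ (unit_itv R))) => t.
apply: (@continuous_max R R (cst 0) (fun t => Num.min 1 t)); first exact: cvg_cst.
by apply: (@continuous_min R R (cst 1) id); [exact: cvg_cst|exact: cvg_id].
Qed.

Lemma clampE (t : R) (u : unit_itv R) : set_val u = t -> clamp t = u.
Proof.
move=> <-; apply: val_inj => /=; have := set_valP u.
by rewrite /unit_itv /= in_itv /= => /andP[u0 u1]; rewrite (min_r u1) (max_r u0).
Qed.

Lemma clamp0 (t : R) : t <= 0 -> clamp t = unit_itv0 R.
Proof.
by move=> t0; apply: val_inj => /=; rewrite max_l// ge_min t0 orbT.
Qed.

Lemma clamp1 (t : R) : 1 <= t -> clamp t = unit_itv1 R.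
Proof. by move=> t1; apply: val_inj => /=; rewrite min_l// max_r. Qed.

Section Fixed.
Variables Z P : topologicalType.

Lemma homotopic_refl (f : Z -> P) : continuous f -> homotopic R f f.
Proof.
move=> cf; exists (f \o fst); split=> // x.
by apply: continuous_comp; [exact: cvg_fst|exact: cf].
Qed.

Lemma reparam_continuous (H : Z * unit_itv R -> P) (phi : R -> R) :
  continuous H -> continuous phi ->
  continuous (fun p : Z * unit_itv R => H (p.1, clamp (phi (set_val p.2)))).
Proof.
move=> cH cphi.
apply: (comp_continuous (g := H)) cH; apply: pair_continuous.
  exact: fst_continuous.
apply: (comp_continuous (g := clamp)) clamp_continuous.
apply: (comp_continuous (g := phi)) cphi.
by apply: comp_continuous; [exact: snd_continuous|exact: unit_itv_val_continuous].
Qed.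

Lemma homotopic_sym (f g : Z -> P) : homotopic R f g -> homotopic R g f.
Proof.
move=> [H [cH H0 H1]].
exists (fun p => H (p.1, clamp (1 - set_val p.2))); split.
- apply: (@reparam_continuous H (fun t => 1 - t)) => // t.
  by apply: cvgB; [exact: cvg_cst|exact: cvg_id].
- by move=> z /=; rewrite clamp1 ?H1// [set_val _]/= subr0.
- by move=> z /=; rewrite clamp0 ?H0// [set_val _]/= subrr.
Qed.

Lemma homotopic_trans (f g h : Z -> P) :
  homotopic R f g -> homotopic R g h -> homotopic R f h.
Proof.
move=> [H [cH H0 H1]] [K [cK K0 K1]].
pose HH (p : Z * unit_itv R) := H (p.1, clamp (2 * set_val p.2)).
pose KK (p : Z * unit_itv R) := K (p.1, clamp (2 * set_val p.2 - 1)).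
pose L (p : Z * unit_itv R) := if (set_val p.2 : R) <= 2^-1 then HH p else KK p.
have clin (c : R) : continuous (fun t : R => 2 * t - c).
  move=> t; apply: cvgB; last exact: cvg_cst.
  by apply: cvgM; [exact: cvg_cst|exact: cvg_id].
have cHH : continuous HH.
  apply: (@reparam_continuous H (fun t => 2 * t)) => //.
  by rewrite [X in continuous X](_ : _ = (fun t => 2 * t - 0))//;
    apply/funext => t; rewrite subr0.
have cKK : continuous KK by apply: (@reparam_continuous K (fun t => 2 * t - 1)).
have cv : continuous (fun p : Z * unit_itv R => set_val p.2 : R).
  by apply: comp_continuous; [exact: snd_continuous|exact: unit_itv_val_continuous].
pose A := [set p : Z * unit_itv R | (set_val p.2 : R) <= 2^-1].
pose B := [set p : Z * unit_itv R | 2^-1 <= (set_val p.2 : R)].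
have cA : closed A.
  exact: (closed_comp (fun x _ => cv x) (@closed_le R 2^-1)).
have cB : closed B.
  exact: (closed_comp (fun x _ => cv x) (@closed_ge R 2^-1)).
have ABT : A `|` B = setT.
  apply/seteqP; split=> // p _; rewrite /A /B /=.
  by case: (lerP (set_val p.2) 2^-1) => [|/ltW]; [left|right].
have half_ge (t : R) : 2^-1 <= t -> 1 <= 2 * t by lra.
have half_le (t : R) : t <= 2^-1 -> 2 * t - 1 <= 0 by lra.
have cL : continuous L.
  apply/continuous_subspace_setT; rewrite -ABT; apply: withinU_continuous => //.
    apply: (@subspace_eq_continuous _ A _ HH); last exact: continuous_subspaceT.
    by move=> p /set_mem Ap; rewrite /from_subspace /L ifT.
  apply: (@subspace_eq_continuous _ B _ KK); last exact: continuous_subspaceT.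
  move=> p /set_mem Bp; rewrite /from_subspace /L; case: ifPn => // Ap.
  have -> : HH p = H (p.1, unit_itv1 R).
    by rewrite /HH clamp1//; exact: half_ge.
  have -> : KK p = K (p.1, unit_itv0 R).
    by rewrite /KK clamp0//; exact: half_le.
  by rewrite H1 K0.
exists L; split => //.
- move=> z; have v0 : set_val (unit_itv0 R) = 0 by [].
  rewrite /L /HH /= v0 ifT; last by lra.
  by rewrite clamp0//; lra.
- move=> z; have v1 : set_val (unit_itv1 R) = 1 by [].
  rewrite /L /KK /= v1 ifF; last by apply/negbTE; rewrite -ltNge; lra.
  by rewrite clamp1//; lra.
Qed.

End Fixed.
End HomotopyEquivalence.

Section HomotopyClasses.
Variables (R : realType) (Z P : topologicalType).

Definition homotopicb (f g : continuousType Z P) : bool :=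
  `[< homotopic R f g >].

Lemma homotopicb_refl : reflexive homotopicb.
Proof. by move=> f; apply/asboolP; apply: homotopic_refl; exact: cts_fun. Qed.

Lemma homotopicb_sym : symmetric homotopicb.
Proof. by move=> f g; apply/asbool_equiv_eq; split; exact: homotopic_sym. Qed.

Lemma homotopicb_trans : transitive homotopicb.
Proof.
move=> g f h /asboolP fg /asboolP gh; apply/asboolP.
exact: homotopic_trans fg gh.
Qed.

Canonical homotopic_equiv :=
  EquivRel homotopicb homotopicb_refl homotopicb_sym homotopicb_trans.

Definition hclasses : Type := {eq_quot homotopic_equiv}.

Definition hclass (f : continuousType Z P) : hclasses :=
  \pi_({eq_quot homotopic_equiv}) f.

Definition hrepr (c : hclasses) : continuousType Z P :=
  repr (c : {eq_quot homotopic_equiv}).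

Lemma hreprK (c : hclasses) : hclass (hrepr c) = c.
Proof. exact: reprK. Qed.

Lemma hclassP (f g : continuousType Z P) :
  hclass f = hclass g <-> homotopic R f g.
Proof.
by split=> [/eqmodP/asboolP//|fg]; apply/eqmodP; apply/asboolP.
Qed.

End HomotopyClasses.

Section HomotopyComposition.
Variable R : realType.

(* Computed on representatives; [hcompE] is independence of the choice. *)
Definition hcomp (Z P Q : topologicalType) (k : hclasses R P Q)
    (h : hclasses R Z P) : hclasses R Z Q :=
  hclass R (hrepr k \o hrepr h : continuousType Z Q).

Lemma homotopic_comp (Z P Q : topologicalType)
    (f f' : continuousType Z P) (g g' : continuousType P Q) :
  homotopic R f f' -> homotopic R g g' -> homotopic R (g \o f) (g' \o f').
Proof.
move=> [H [cH H0 H1]] [K [cK K0 K1]].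
apply: (@homotopic_trans R _ _ _ (g \o f')).
  exists (g \o H); split=> [p|z|z] /=; rewrite ?H0 ?H1//.
  by apply: continuous_comp; [exact: cH|exact: cts_fun].
exists (fun p => K (f' p.1, p.2)); split=> [p|z|z] /=; rewrite ?K0 ?K1//.
apply: (comp_continuous (g := K)) cK p.
apply: pair_continuous; last exact: snd_continuous.
by apply: comp_continuous; [exact: fst_continuous|exact: cts_fun].
Qed.

Lemma hcompE (Z P Q : topologicalType) (k : continuousType P Q)
    (h : continuousType Z P) :
  hcomp (hclass R k) (hclass R h) = hclass R (k \o h : continuousType Z Q).
Proof.
by apply/hclassP; apply: homotopic_comp; apply/hclassP; exact: hreprK.
Qed.

End HomotopyComposition.

Definition homeomorphic (T U : topologicalType) : Prop :=
  exists (f : T -> U) (g : U -> T),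
    [/\ continuous f, continuous g, cancel f g & cancel g f].

Definition metrizable (R : realType) (T : topologicalType) : Prop :=
  exists M : metricType R, homeomorphic T M.

(* [U] and [A] are the subtypes, with their subspace topologies, in [r]. *)
Definition neighborhood_retract (M : topologicalType) (A : set M) : Prop :=
  exists U : set M,
    [/\ open U, A `<=` U &
        exists r : U -> A,
          continuous r /\
          forall u : U, A (set_val u) -> set_val (r u) = set_val u].

Definition is_metric_ANR (R : realType) (P : topologicalType) : Prop :=
  metrizable R P /\
  forall (M : topologicalType) (A : set M),
    metrizable R M -> closed A -> homeomorphic P A -> neighborhood_retract A.

Record metricANR (R : realType) := MetricANR {
  ANR_space :> topologicalType;
  ANR_axiom : is_metric_ANR R ANR_space
}.

Section Shape.
Variable R : realType.

(* A morphism from [X] to [Y]: note the contravariance. *)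
Record shape_mor (X Y : topologicalType) := ShapeMor {
  shape_nat :> forall P : metricANR R, hclasses R Y P -> hclasses R X P;
  shape_natural : forall (P Q : metricANR R) (k : hclasses R P Q)
    (h : hclasses R Y P), shape_nat (hcomp k h) = hcomp k (shape_nat h)
}.

Lemma shape_morP (X Y : topologicalType) (F G : shape_mor X Y) :
  (forall (P : metricANR R) (h : hclasses R Y P), F P h = G P h) -> F = G.
Proof.
case: F G => F nF [G nG] /= FG.
have {}FG : F = G by apply: functional_extensionality_dep => P; exact/funext.
by case: _ / FG nG => nG; congr ShapeMor; exact: Prop_irrelevance.
Qed.

Definition shape_id (X : topologicalType) : shape_mor X X :=
  @ShapeMor X X (fun _ h => h) (fun _ _ _ _ => erefl).

Lemma shape_comp_natural (X Y W : topologicalType) (G : shape_mor Y W)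
    (F : shape_mor X Y) (P Q : metricANR R) (k : hclasses R P Q)
    (h : hclasses R W P) :
  F Q (G Q (hcomp k h)) = hcomp k (F P (G P h)).
Proof. by rewrite !shape_natural. Qed.

(* [G] after [F] *)
Definition shape_comp (X Y W : topologicalType) (G : shape_mor Y W)
    (F : shape_mor X Y) : shape_mor X W :=
  ShapeMor (shape_comp_natural G F).

Definition same_shape (X Y : topologicalType) : Prop :=
  exists (F : shape_mor X Y) (G : shape_mor Y X),
    shape_comp G F = shape_id X /\ shape_comp F G = shape_id Y.

End Shape.

(* Main.v *)
(** A metric ANR [P] is Hausdorff, so every map [X -> P] factors through the
    projection [X -> X_H]; thus [[X_H, P] -> [X, P]] is onto.  It is also
    one-to-one: as [P] is Hausdorff, so is the space of paths in [P] with the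
    compact-open topology, and a homotopy [X * [0, 1] -> P], curried to a map
    from [X] to that space, again factors through [X_H]; since [[0, 1]] is
    compact, the factor uncurries to a homotopy on [X_H * [0, 1]].  The inverses
    of these natural bijections form the inverse shape morphism. *)

Require Import Defs.
From HB Require Import structures.
From mathcomp Require Import all_boot all_order all_algebra.
From mathcomp Require Import all_classical all_reals all_analysis.

Set Implicit Arguments.
Unset Strict Implicit.
Unset Printing Implicit Defensive.

Import numFieldNormedType.Exports.

Local Open Scope classical_set_scope.
Local Open Scope ring_scope.

(** If all neighbourhoods of two points meet, so do those of their images under a continuous map;
    hence no map to a Hausdorff space tells such points apart. *)
Lemma R3_hausdorff (T : topologicalType) :
  (forall x y : T, R3 x y -> x = y) -> hausdorff_space T.
Proof.
move=> sep x y clxy; apply: sep => Z f hZ cf; apply: hZ => A B Ax By.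
by have [z [Az Bz]] := clxy _ _ (cf _ _ Ax) (cf _ _ By); exists (f z).
Qed.

Lemma injective_hausdorff (T U : topologicalType) (f : T -> U) :
  hausdorff_space U -> continuous f -> injective f -> hausdorff_space T.
Proof.
by move=> hU cf fI; apply: R3_hausdorff => x y xy; apply: fI; exact: xy.
Qed.

Lemma metrizable_hausdorff (R : realType) (T : topologicalType) :
  metrizable R T -> hausdorff_space T.
Proof.
move=> [M [f [g [cf _ fK _]]]].
exact: (injective_hausdorff (@metric_hausdorff R M) cf (can_inj fK)).
Qed.

Lemma compact_open_eval_continuous (T U : topologicalType) (t : T) :
  continuous (fun f : {compact-open, T -> U} => f t).
Proof.
move=> f A; rewrite /= nbhsE => -[V [oV Vft] VA].
(* A singleton is compact, so this set is a subbasic open set. *)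
apply: (@filterS _ _ _ [set g : {compact-open, T -> U} | g @` [set t] `<=` V]).
  by move=> g gV; apply: VA; apply: gV; exists t.
apply: open_nbhs_nbhs; split; last by move=> _ [_ -> <-].
by apply: compact_open_open => //; exact: compact_set1.
Qed.

(** Evaluations at points are continuous into [U] and jointly separate functions. *)
Lemma compact_open_hausdorff (T U : topologicalType) :
  hausdorff_space U -> hausdorff_space {compact-open, T -> U}.
Proof.
move=> hU; apply: R3_hausdorff => f g fg; apply/funext => t.
exact: (fg U _ hU (@compact_open_eval_continuous T U t)).
Qed.

Lemma unit_itv_hausdorff (R : realType) : hausdorff_space (unit_itv R).
Proof.
apply: (injective_hausdorff (@Rhausdorff R)).
  exact: unit_itv_val_continuous.
exact: val_inj.
Qed.

Lemma unit_itv_compact (R : realType) : compact [set: unit_itv R].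
Proof.
(* [clamp] retracts the line onto the subtype, which carries compactness over from the segment. *)
rewrite (_ : setT = @clamp R @` `[0, 1]).
  apply: continuous_compact; last exact: segment_compact.
  by apply: continuous_subspaceT; exact: clamp_continuous.
apply/esym/seteqP; split=> // u _.
by exists (set_val u); [exact: set_valP|exact: clampE].
Qed.

Lemma unit_itv_locally_compact (R : realType) :
  locally_compact [set: unit_itv R].
Proof.
move=> u _; exists setT; first exact: filterT.
by split; [exact: unit_itv_compact|exact: closedT].
Qed.

Lemma hausdorff_proj_homotopic (R : realType) (X P : topologicalType)
    (f g : hausdorff_reflection X -> P) :
  hausdorff_space P ->
  homotopic R (f \o @hausdorff_proj X) (g \o @hausdorff_proj X) ->
  homotopic R f g.
Proof.
move=> hP [H [cH H0 H1]].
have [cH' cHx] := continuous_curry cH.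
have [K cK HK] := hausdorff_reflection_factor
  (@compact_open_hausdorff (unit_itv R) P hP) cH'.
have KE x : K (hausdorff_proj x) = curry H x by rewrite HK.
exists (uncurry K); split=> [|q|q]; last 2 first.
- by have [x <-] := hausdorff_proj_surj q; rewrite /uncurry KE; exact: H0.
- by have [x <-] := hausdorff_proj_surj q; rewrite /uncurry KE; exact: H1.
apply: continuous_uncurry => //.
- exact: unit_itv_locally_compact.
- exact: unit_itv_hausdorff.
(* The compact-open space contains all functions, so each [K q] must be shown to be a path: it is
   [curry H x] for some [x] over [q]. *)
- by move=> q; have [x <-] := hausdorff_proj_surj q; rewrite KE; exact: cHx.
Qed.

Section InducedMorphism.
Variables (R : realType) (X Y : topologicalType) (f : continuousType X Y).

Lemma shape_induced_natural (P Q : topologicalType) (k : hclasses R P Q)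
    (h : hclasses R Y P) :
  hcomp (hcomp k h) (hclass R f) = hcomp k (hcomp h (hclass R f)).
Proof.
rewrite -(hreprK k) -(hreprK h) !hcompE.
by congr hclass; apply/continuousEP.
Qed.

Definition shape_induced : shape_mor R X Y :=
  @ShapeMor R X Y (fun P h => hcomp h (hclass R f))
    (fun P Q => @shape_induced_natural P Q).

Lemma shape_induced_iso :
  (forall P : metricANR R, bijective (@shape_induced P)) -> same_shape R X Y.
Proof.
move=> bij.
have inv (P : metricANR R) : {G : hclasses R X P -> hclasses R Y P |
    cancel (@shape_induced P) G /\ cancel G (@shape_induced P)}.
  by apply: cid; have [G GK KG] := bij P; exists G.
pose G (P : metricANR R) := sval (inv P).
have GK (P : metricANR R) : cancel (@shape_induced P) (G P)
  by case: (svalP (inv P)).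
have KG (P : metricANR R) : cancel (G P) (@shape_induced P)
  by case: (svalP (inv P)).
have Gnat (P Q : metricANR R) (k : hclasses R P Q) (h : hclasses R X P) :
    G Q (hcomp k h) = hcomp k (G P h).
  (* Write [h] as the image of [G P h], pull [shape_induced] out of the composite by naturality,
     then cancel it against [G Q]. *)
  by rewrite -[in LHS](KG P h) -shape_natural GK.
exists shape_induced, (ShapeMor Gnat).
(* By contravariance the composite on [X] applies [G] first, hence [KG] there and [GK] on [Y]. *)
by split; apply: shape_morP => P h; [exact: KG|exact: GK].
Qed.

End InducedMorphism.

HB.instance Definition _ (X : topologicalType) :=
  isContinuous.Build X (hausdorff_reflection X) (@hausdorff_proj X)
    (@hausdorff_proj_continuous X).

Lemma hausdorff_proj_hcomp_bij (R : realType) (X P : topologicalType) :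
  hausdorff_space P ->
  bijective (fun h : hclasses R (hausdorff_reflection X) P =>
    hcomp h (hclass R (@hausdorff_proj X))).
Proof.
move=> hP; set F := fun h => _.
have Finj : injective F.
  move=> h h'; rewrite /F -(hreprK h) -(hreprK h') !hcompE => /hclassP hh'.
  by apply/hclassP; exact: hausdorff_proj_homotopic hh'.
(* A factor of a representative of [c] gives a preimage; choosing one for each [c] defines the
   inverse. *)
have Fsurj c : {h | F h = c}.
  apply: cid; rewrite -(hreprK c).
  have [g cg gE] := hausdorff_reflection_factor hP (@cts_fun _ _ (hrepr c)).
  pose g' : continuousType _ _ := HB.pack g (isContinuous.Build _ _ g cg).
  exists (hclass R g'); rewrite /F hcompE.
  by congr hclass; apply/continuousEP => x; rewrite gE.
exists (fun c => sval (Fsurj c)) => [h|c]; last exact: svalP (Fsurj c).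
by apply: Finj; exact: svalP (Fsurj (F h)).
Qed.

Theorem theorem2 (R : realType) (X : topologicalType) :
  same_shape R X (hausdorff_reflection X).
Proof.
apply: (@shape_induced_iso R X _ (@hausdorff_proj X)) => P.
apply: hausdorff_proj_hcomp_bij.
exact: (metrizable_hausdorff (ANR_axiom P).1).
Qed.
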